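(* Consider a dynamic heterogeneous vehicle platoon with $N$ initial follower vehicles, in which $N_{ci}$ cut-in maneuvers occur at times $t_{ci,1},\dots,t_{ci,N_{ci}}$ and $N_{co}$ cut-out maneuvers occur at times $t_{co,1},\dots,t_{co,N_{co}}$ (times measured in time steps), and which is controlled by the distributed nonlinear model predictive controller (DNMPC) described in the context. Let $\mathcal{N}_{ci}=\{1,\dots,N_{ci}\}$ and $\mathcal{N}_{co}=\{1,\dots,N_{co}\}$. If the directed graph of the platoon communication topology contains a spanning tree rooted at the leader vehicle, then the DNMPC optimization problem guarantees convergence of the output to the desired output in at most $$t_{\mathrm{conv}} := \max_{i,j}\big[t_{ci,i},\, t_{co,j} \,\big|\, i\in\mathcal{N}_{ci},\, j\in\mathcal{N}_{co}\big] + N + N_{ci} - N_{co}$$ time steps; that is, $y_i^p(N_p|t) = y_{\mathrm{des},i}(N_p|t)$ for every follower vehicle $i$ in the platoon and all $t\ge t_{\mathrm{conv}}$.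
   Context: Platoon model. A platoon has a leader vehicle (LV, index 0) and follower vehicles (FVs) indexed by $\mathcal{N}=\{1,\dots,N\}$. Let $\Delta t>0$ be the sampling time. FV $i$ has state $x_i(t)=[s_i(t),v_i(t),T_i(t)]^\top$ (position, velocity, torque), output $y_i(t)=\gamma x_i(t)=[s_i(t),v_i(t)]^\top$ with $\gamma=\begin{bmatrix}1&0&0\\0&1&0\end{bmatrix}$, scalar control input $u_i(t)$, and dynamics $x_i(t+1)=\phi_i(x_i(t))+u_i(t)\psi_i$, where $\psi_i=[0,0,\Delta t/\tau_i]^\top$ and $$\phi_i(x_i)=\Big[s_i+v_i\Delta t,\ v_i+\tfrac{\Delta t}{m_i}\big(\tfrac{\eta_i}{r_i}T_i-C_{A,i}v_i^2-m_i g f_i\big),\ T_i-\tfrac{1}{\tau_i}T_i\Delta t\Big]^\top.$$ The positive constants $m_i,C_{A,i},f_i,\tau_i,r_i,\eta_i$ (possibly different for each vehicle) are mass, drag coefficient, rolling resistance coefficient, inertial lag, tire radius and driveline efficiency; $g$ is the gravity constant. Set $h_i(v):=(r_i/\eta_i)(C_{A,i}v^2+m_i g f_i)$. Communication. $a_{ij}=1$ if FV $j$ can send information to FV $i$, and $a_{ij}=0$ otherwise; $p_i=1$ if FV $i$ receives information from the LV, and $p_i=0$ otherwise. The topology is unidirectional: information flows only from front to back, so $a_{ij}=1$ only if $j<i$. Set $\mathbb{P}_i=\{0\}$ if $p_i=1$ and $\mathbb{P}_i=\varnothing$ if $p_i=0$; $\mathbb{N}_i=\{j\in\mathcal{N}: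 a_{ij}=1\}$; $\mathbb{O}_i=\{j\in\mathcal{N}: a_{ji}=1\}$; $\mathbb{I}_i=\mathbb{N}_i\cup\mathbb{P}_i$. The graph on $\{0,\dots,N\}$ has an edge from $j$ to $i$ iff $j\in\mathbb{I}_i$. Desired behaviour. The LV has constant speed $v_0$ and position $s_0(t)$; $d$ is the desired gap between consecutive vehicles. The desired output of FV $i$ at prediction step $k$ from time $t$ is $y_{\mathrm{des},i}(k|t)=[s_0(t)+k v_0\Delta t-i d,\ v_0]^\top$. The vector $\widetilde d_{i,j}=[d_{i,j},0]^\top$ is the desired (signed) position offset of vehicle $i$ relative to vehicle $j$, $d_{i,j}=(j-i)d$. DNMPC. Let $N_p$ be the prediction horizon. For a positive semidefinite matrix $A$ write $\|x\|_A:=x^\top A x$. At each time step $t$ each FV $i$ solves, over $u_i^p(0|t),\dots,u_i^p(N_p-1|t)$, the problem of minimizing $$J_i=\sum_{k=0}^{N_p-1}\Big(\|y_i^p(k|t)-y_{\mathrm{des},i}(k|t)\|_{Q_i}+\|u_i^p(k|t)-h_i(v_i^p(k|t))\|_{R_i}+\|y_i^p(k|t)-y_i^a(k|t)\|_{F_i}+\sum_{j\in\mathbb{N}_i}\|y_i^p(k|t)-y_j^a(k|t)-\widetilde d_{i,j}\|_{G_i}\Big)$$ subject to $x_i^p(k+1|t)=\phi_i(x_i^p(k|t))+u_i^p(k|t)\psi_i$, $y_i^p(k|t)=\gamma x_i^p(k|t)$, $x_i^p(0|t)=x_i(t)$, $u_i^p(k|t)\in[u_{\min,i},u_{\max,i}]$,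 $y_i^p(N_p|t)=\frac{1}{|\mathbb{I}_i|}\sum_{j\in\mathbb{I}_i}\big(y_j^a(N_p|t)+\widetilde d_{i,j}\big)$, and $T_i^p(N_p|t)=h_i(v_i^p(N_p|t))$. Here $Q_i,F_i,G_i\in\mathbb{R}^{2\times 2}$ are positive semidefinite, $R_i\ge 0$, and $Q_i=0$ if $p_i=0$. Superscript $p$ denotes predicted quantities (those of the optimal solution) and superscript $a$ assumed quantities, obtained by shifting the optimal solution of the previous step: the assumed input at time $t+1$ is $u_i^a(k|t+1)=u_i^*(k+1|t)$ for $0\le k\le N_p-2$ and $u_i^a(N_p-1|t+1)=h_i(v_i^*(N_p|t))$, with assumed states and outputs generated by the dynamics from $x_i^a(0|t+1)=x_i^*(1|t)$. Initially the assumed trajectory is the constant-speed trajectory with $u_i^a(k|0)=h_i(v_i(0))$ and assumed torque $h_i(v_i(0))$. For the leader, $y_0^a(k|t)=[s_0(t)+k v_0\Delta t,\ v_0]^\top$. The applied control is $u_i(t)=u_i^*(0|t)$. Dynamic platoon. A cut-in adds one FV to the platoon and a cut-out removes one FV from it. After each maneuver the FVs are re-indexed by order, the communication sets and desired outputs are those of the new platoon, and the DNMPC continues with the new platoon. The topology is unidirectional and contains a spanning tree rooted at the LV throughout. If there are no maneuvers, the maximum is taken to be $0$. *)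

(* Defs.v *)
From HB Require Import structures.
From mathcomp Require Import all_boot all_order all_algebra reals.
Set Implicit Arguments.
Unset Strict Implicit.
Unset Printing Implicit Defensive.
Import Order.TTheory GRing.Theory Num.Theory.
Local Open Scope ring_scope.

Definition col2 (R : realType) (a b : R) : 'cV[R]_2 := \col_i [:: a; b]`_i.
Definition col3 (R : realType) (a b c : R) : 'cV[R]_3 := \col_i [:: a; b; c]`_i.

(* The weighted square x^T A x (no square root). *)
Definition wsq (R : realType) (n : nat) (A : 'M[R]_n) (x : 'cV[R]_n) : R :=
  (x^T *m A *m x) 0 0.

Definition psd (R : realType) (n : nat) (A : 'M[R]_n) : Prop :=
  A^T = A /\ forall x : 'cV[R]_n, 0 <= wsq A x.

Definition rooted_tree (T : finType) (r : T) (e : rel T) : Prop :=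
  [/\ forall j, ~~ e j r,
      forall i, i != r -> #|[pred j | e j i]| = 1%N
    & forall i, connect e r i].

Definition contains_spanning_tree (T : finType) (r : T) (e : rel T) : Prop :=
  exists2 e' : rel T, subrel e' e & rooted_tree r e'.

Record vehicle (R : realType) := Vehicle {
  mass : R;
  drag : R;
  roll : R;
  lag : R;
  radius : R;
  effic : R;
  umin : R;
  umax : R
}.

(* [V] is a type of vehicle identities: a follower keeps its identity (hence
   its physical constants, state and past optimal solutions) when a maneuver
   changes its index in the platoon.  [lv] is the identity of the leader. *)
Record setting (R : realType) (V : eqType) := Setting {
  dt : R;
  grav : R;
  horizon : nat;
  gap : R;
  lv : V;
  v0 : R;
  s0 : nat -> R;
  veh : V -> vehicle R
}.

Definition vehicle_ok (R : realType) (p : vehicle R) : Prop :=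
  [/\ 0 < mass p, 0 < drag p & 0 < roll p] /\
  [/\ 0 < lag p, 0 < radius p & 0 < effic p].

Definition setting_ok (R : realType) (V : eqType) (E : setting R V) : Prop :=
  [/\ 0 < dt E, 0 < grav E, (0 < horizon E)%N,
      forall t, s0 E t.+1 = s0 E t + v0 E * dt E
    & forall c, vehicle_ok (veh E c)].

Definition pos (R : realType) (x : 'cV[R]_3) : R := x 0 0.
Definition vel (R : realType) (x : 'cV[R]_3) : R := x 1 0.
Definition torque (R : realType) (x : 'cV[R]_3) : R := x 2%:R 0.

Definition gamma (R : realType) : 'M[R]_(2, 3) :=
  \matrix_(i < 2, j < 3) (i == j :> nat)%:R.

Definition output (R : realType) (x : 'cV[R]_3) : 'cV[R]_2 := gamma R *m x.

Definition phi (R : realType) (V : eqType) (E : setting R V) (p : vehicle R)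
    (x : 'cV[R]_3) : 'cV[R]_3 :=
  let s := pos x in let v := vel x in let T := torque x in
  col3 (s + v * dt E)
       (v + dt E / mass p *
              (effic p / radius p * T - drag p * v ^+ 2
               - mass p * grav E * roll p))
       (T - 1 / lag p * T * dt E).

Definition psi (R : realType) (V : eqType) (E : setting R V) (p : vehicle R) :
    'cV[R]_3 := col3 0 0 (dt E / lag p).

Definition htorque (R : realType) (V : eqType) (E : setting R V)
    (p : vehicle R) (v : R) : R :=
  radius p / effic p * (drag p * v ^+ 2 + mass p * grav E * roll p).

Fixpoint traj (R : realType) (V : eqType) (E : setting R V) (p : vehicle R)
    (x0 : 'cV[R]_3) (u : nat -> R) (k : nat) : 'cV[R]_3 :=
  match k with
  | 0 => x0
  | k'.+1 => let x := traj E p x0 u k' in phi E p x + u k' *: psi E p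
  end.

(* Indices are 1..N for the followers and 0 for the leader; values of the
   fields at other indices are irrelevant.  [com c i j] is a_ij = 1 and
   [hears c i] is p_i = 1. *)
Record config (R : realType) := Config {
  com : nat -> nat -> bool;
  hears : nat -> bool;
  Qw : nat -> 'M[R]_2;
  Rw : nat -> R;
  Fw : nat -> 'M[R]_2;
  Gw : nat -> 'M[R]_2
}.

Definition Pset (R : realType) (c : config R) (N i : nat) : {set 'I_N.+1} :=
  if hears c i then [set ord0] else set0.

Definition Nset (R : realType) (c : config R) (N i : nat) : {set 'I_N.+1} :=
  [set j : 'I_N.+1 | (0 < j)%N && com c i j].

Definition Iset (R : realType) (c : config R) (N i : nat) : {set 'I_N.+1} :=
  Nset c N i :|: Pset c N i.

(* Only followers have a set I_i, so the leader has no incoming edge. *)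
Definition com_graph (R : realType) (c : config R) (N : nat) : rel 'I_N.+1 :=
  fun j i => (i != ord0) && (j \in Iset c N i).

Definition unidirectional (R : realType) (c : config R) (N : nat) : Prop :=
  forall i j, (1 <= i <= N)%N -> (1 <= j <= N)%N -> com c i j -> (j < i)%N.

Definition weights_ok (R : realType) (c : config R) (N : nat) : Prop :=
  forall i, (1 <= i <= N)%N ->
    [/\ psd (Qw c i), psd (Fw c i), psd (Gw c i), 0 <= Rw c i
      & ~~ hears c i -> Qw c i = 0].

Definition y_des (R : realType) (V : eqType) (E : setting R V) (i k t : nat) :
    'cV[R]_2 :=
  col2 (s0 E t + k%:R * v0 E * dt E - i%:R * gap E) (v0 E).

Definition y_lead (R : realType) (V : eqType) (E : setting R V) (k t : nat) :
    'cV[R]_2 :=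
  col2 (s0 E t + k%:R * v0 E * dt E) (v0 E).

Definition offset (R : realType) (V : eqType) (E : setting R V) (i j : nat) :
    'cV[R]_2 :=
  col2 ((j%:R - i%:R) * gap E) 0.

(* Below, [ya j k] is the assumed output y_j^a(k|t) of the vehicle of index
   [j], for j = 0..N, and [x0] is the current state of follower [i]. *)
Definition cost (R : realType) (V : eqType) (E : setting R V) (c : config R)
    (N t i : nat) (p : vehicle R) (ya : nat -> nat -> 'cV[R]_2)
    (x0 : 'cV[R]_3) (u : nat -> R) : R :=
  \sum_(k < horizon E)
    let x := traj E p x0 u k in
    let y := output x in
    (wsq (Qw c i) (y - y_des E i k t)
     + Rw c i * (u k - htorque E p (vel x)) ^+ 2
     + wsq (Fw c i) (y - ya i k)
     + \sum_(j in Nset c N i) wsq (Gw c i) (y - ya j k - offset E i j)).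

Definition feasible (R : realType) (V : eqType) (E : setting R V)
    (c : config R) (N i : nat) (p : vehicle R) (ya : nat -> nat -> 'cV[R]_2)
    (x0 : 'cV[R]_3) (u : nat -> R) : Prop :=
  let xN := traj E p x0 u (horizon E) in
  [/\ forall k, (k < horizon E)%N -> umin p <= u k <= umax p,
      output xN = (#|Iset c N i|%:R)^-1 *:
        \sum_(j in Iset c N i) (ya j (horizon E) + offset E i j)
    & torque xN = htorque E p (vel xN)].

Definition optimal (R : realType) (V : eqType) (E : setting R V)
    (c : config R) (N t i : nat) (p : vehicle R)
    (ya : nat -> nat -> 'cV[R]_2) (x0 : 'cV[R]_3) (u : nat -> R) : Prop :=
  feasible E c N i p ya x0 u /\
  forall u', feasible E c N i p ya x0 u' ->
    cost E c N t i p ya x0 u <= cost E c N t i p ya x0 u'.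

(* [CutIn t n c]: at time [t] vehicle [c] enters behind the first [n]
   followers.  [CutOut t c]: at time [t] follower [c] leaves. *)
Inductive maneuver (V : Type) :=
  | CutIn of nat & nat & V
  | CutOut of nat & V.

Definition mtime (V : Type) (m : maneuver V) : nat :=
  match m with CutIn t _ _ => t | CutOut t _ => t end.

Definition is_cut_in (V : Type) (m : maneuver V) : bool :=
  match m with CutIn _ _ _ => true | CutOut _ _ => false end.

Definition apply_maneuver (V : eqType) (P : seq V) (m : maneuver V) : seq V :=
  match m with
  | CutIn _ n c => take n P ++ c :: drop n P
  | CutOut _ c => rem c P
  end.

Fixpoint executable (V : eqType) (l : V) (P : seq V) (log : seq (maneuver V)) :
    bool :=
  match log with
  | [::] => true
  | m :: log' =>
      match m with
      | CutIn _ n c => (n <= size P)%N && (c \notin l :: P)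
      | CutOut _ c => c \in P
      end && executable l (apply_maneuver P m) log'
  end.

Definition valid_log (V : eqType) (l : V) (P : seq V)
    (log : seq (maneuver V)) : Prop :=
  sorted leq [seq mtime m | m <- log] /\ executable l P log.

(* Number of maneuvers performed up to time [t]. *)
Definition stage (V : Type) (log : seq (maneuver V)) (t : nat) : nat :=
  count (fun m => mtime m <= t)%N log.

(* The followers, from front to back, whose controllers run at time [t]: a
   maneuver at time [t] is already taken into account at time [t]. *)
Definition platoon (V : eqType) (P0 : seq V) (log : seq (maneuver V))
    (t : nat) : seq V :=
  foldl (@apply_maneuver V) P0 (take (stage log t) log).

(* Vehicle of index [i] in the platoon with followers [P]. *)
Definition member (V : eqType) (l : V) (P : seq V) (i : nat) : V :=
  nth l (l :: P) i.

(* The data at time [t] for the vehicle [c]; meaningful when [c] is in the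
   platoon at time [t].  Inputs are used at steps k < horizon only. *)
Record run (R : realType) (V : eqType) := Run {
  state : nat -> V -> 'cV[R]_3;
  uopt : nat -> V -> nat -> R;
  uass : nat -> V -> nat -> R;
  xass0 : nat -> V -> 'cV[R]_3
}.

Definition xpred (R : realType) (V : eqType) (E : setting R V) (X : run R V)
    (t : nat) (c : V) (k : nat) : 'cV[R]_3 :=
  traj E (veh E c) (state X t c) (uopt X t c) k.

Definition xass (R : realType) (V : eqType) (E : setting R V) (X : run R V)
    (t : nat) (c : V) (k : nat) : 'cV[R]_3 :=
  traj E (veh E c) (xass0 X t c) (uass X t c) k.

Definition yass (R : realType) (V : eqType) (E : setting R V) (X : run R V)
    (P : seq V) (t j k : nat) : 'cV[R]_2 :=
  if j == 0%N then y_lead E k t else output (xass E X t (member (lv E) P j) k).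

Definition ypred (R : realType) (V : eqType) (E : setting R V) (X : run R V)
    (P : seq V) (t i k : nat) : 'cV[R]_2 :=
  output (xpred E X t (member (lv E) P i) k).

(* [cfg n] is the configuration in force after [n] maneuvers.  No condition is
   put on the first assumed trajectory of a vehicle that cuts in after time 0
   except that it obeys the dynamics. *)
Record closed_loop (R : realType) (V : eqType) (E : setting R V) (P0 : seq V)
    (log : seq (maneuver V)) (cfg : nat -> config R) (X : run R V) : Prop :=
  ClosedLoop {
    loop_optimal : forall t i,
      let P := platoon P0 log t in
      let c := member (lv E) P i in
      (1 <= i <= size P)%N ->
      optimal E (cfg (stage log t)) (size P) t i (veh E c)
        (yass E X P t) (state X t c) (uopt X t c);
    loop_state : forall t c, c \in platoon P0 log t ->
      state X t.+1 c =
        phi E (veh E c) (state X t c) + uopt X t c 0%N *: psi E (veh E c);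
    loop_init : forall c, c \in platoon P0 log 0 ->
      let x := state X 0 c in
      let h := htorque E (veh E c) (vel x) in
      xass0 X 0 c = col3 (pos x) (vel x) h /\
      forall k, (k < horizon E)%N -> uass X 0 c k = h;
    loop_shift : forall t c,
      c \in platoon P0 log t -> c \in platoon P0 log t.+1 ->
      xass0 X t.+1 c = xpred E X t c 1 /\
      forall k, (k < horizon E)%N ->
        uass X t.+1 c k =
          if (k.+1 < horizon E)%N then uopt X t c k.+1
          else htorque E (veh E c) (vel (xpred E X t c (horizon E)))
  }.

(* Main.v *)
Require Import Defs.
From HB Require Import structures.
From mathcomp Require Import all_boot all_order all_algebra reals.
Set Implicit Arguments.
Unset Strict Implicit.
Unset Printing Implicit Defensive.
Import Order.TTheory GRing.Theory Num.Theory.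
Local Open Scope ring_scope.

(** Two facts drive the proof.  The terminal constraint makes the last predicted
    state an equilibrium of the velocity and torque dynamics, so extending the
    shifted optimal trajectory by the input h(v) moves the vehicle at constant
    speed: the terminal assumed output at time t+1 is the terminal predicted
    output at time t, advanced by one step at its own speed
    ([output_xass_horizon]).  In particular a vehicle whose terminal prediction
    is the desired output at time t announces the desired output at time t+1.
    The other terminal constraint says that the terminal predicted output of
    follower i is the mean of what its in-neighbours announce, corrected by the
    offsets; if all of them announce their desired output, this mean is the
    desired output of i ([ypred_desired_step]).

    In-neighbours are strictly in front, and the spanning tree gives every
    follower at least one.  Hence, once the platoon no longer changes, the
    correct terminal output spreads from the leader, which announces its own
    from the start, by at least one index per time step: follower i is correct
    i - 1 steps after the last maneuver ([ypred_desired_constant_platoon]).  It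
    remains to count that the final platoon has N + Nci - Nco followers. *)

Section Platoon.

Context (R : realType) (V : eqType) (E : setting R V).

(** * Constant-speed extension of the optimal trajectory *)

Lemma outputE (x : 'cV[R]_3) : output x = col2 (pos x) (vel x).
Proof.
apply/matrixP => i j; rewrite ord1 !mxE !big_ord_recl big_ord0 !mxE.
by case: i => [[|[|i]] ilt] //=;
  rewrite ?mul1r ?mul0r ?addr0 ?add0r; congr (x _ _); apply: val_inj.
Qed.

Lemma col2D (a b a' b' : R) : col2 a b + col2 a' b' = col2 (a + a') (b + b').
Proof. by apply/matrixP => i j; rewrite !mxE; case: i => [[|[|]]]. Qed.

Lemma col2_inj (a b a' b' : R) : col2 a b = col2 a' b' -> a = a' /\ b = b'.
Proof.
by move=> /matrixP ab; split; [move: (ab 0 0) | move: (ab 1 0)]; rewrite !mxE.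
Qed.

Lemma traj_shift p x0 (u : nat -> R) k :
  traj E p (traj E p x0 u 1) (fun n => u n.+1) k = traj E p x0 u k.+1.
Proof. by elim: k => // k IHk; rewrite [LHS]/= IHk. Qed.

Lemma eq_traj p x0 (u u' : nat -> R) k :
  (forall n, (n < k)%N -> u n = u' n) -> traj E p x0 u k = traj E p x0 u' k.
Proof.
elim: k => // k IHk uu'; rewrite /= uu' // IHk // => n nk.
exact/uu'/leqW.
Qed.

(** The torque h(v) exactly balances drag and rolling resistance, which leaves
    the velocity unchanged whatever the input is. *)
Lemma output_phi_equilibrium p (x : 'cV[R]_3) (a : R) :
  vehicle_ok p -> torque x = htorque E p (vel x) ->
  output (phi E p x + a *: psi E p) = col2 (pos x + vel x * dt E) (vel x).
Proof.
move=> [[m0 _ _] [_ r0 e0]] Tx.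
rewrite outputE /pos /vel !mxE /= mulr0 !addr0; congr (col2 _ _).
rewrite -/(vel x) Tx /htorque mulrA.
rewrite mulrACA [effic p * _]mulrC mulrACA !divff ?gt_eqF // !mul1r.
by rewrite addrAC addrK subrr mulr0 addr0.
Qed.

Lemma y_des_leader k t : y_lead E k t = y_des E 0 k t.
Proof. by rewrite /y_lead /y_des mul0r subr0. Qed.

Lemma y_des_offset i j k t : y_des E j k t + offset E i j = y_des E i k t.
Proof.
by rewrite /y_des /offset col2D addr0; congr (col2 _ _);
  rewrite mulrBl addrA subrK.
Qed.

Lemma y_des_next i k t (x : 'cV[R]_3) :
  s0 E t.+1 = s0 E t + v0 E * dt E -> output x = y_des E i k t ->
  col2 (pos x + vel x * dt E) (vel x) = y_des E i k t.+1.
Proof.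
move=> s0S; rewrite outputE => /col2_inj[-> ->].
rewrite /y_des s0S; congr (col2 _ _).
by rewrite addrAC; congr (_ - _); rewrite addrAC.
Qed.

(** * Propagation along the communication graph *)

Section Loop.

Context (P0 : seq V) (log : seq (maneuver V)).
Context (cfg : nat -> config R) (X : run R V).
Context (E_ok : setting_ok E) (X_loop : closed_loop E P0 log cfg X).

Lemma member_mem (l : V) P i : (1 <= i <= size P)%N -> member l P i \in P.
Proof. by case: i => // i ilt; apply: mem_nth. Qed.

Lemma xass_horizon t c :
  c \in platoon P0 log t -> c \in platoon P0 log t.+1 ->
  let xH := xpred E X t c (horizon E) in
  xass E X t.+1 c (horizon E) =
    phi E (veh E c) xH + htorque E (veh E c) (vel xH) *: psi E (veh E c).
Proof.
move=> ct ct1; have [x0S uS] := loop_shift X_loop ct ct1.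
have [_ _ H0 _ _] := E_ok.
rewrite /xass x0S; case: (horizon E) H0 uS => // h _ uS /=.
rewrite (uS h) // ltnn; congr (phi _ _ _ + _);
  rewrite -[RHS]traj_shift; apply: eq_traj => n nh;
  by rewrite uS ?ltnS ?nh // ltnW.
Qed.

(** The shifted inputs retrace the previous prediction from its second state on;
    the one appended step starts at its terminal equilibrium. *)
Lemma output_xass_horizon t c :
  c \in platoon P0 log t -> c \in platoon P0 log t.+1 ->
  let xH := xpred E X t c (horizon E) in
  torque xH = htorque E (veh E c) (vel xH) ->
  output (xass E X t.+1 c (horizon E)) =
    col2 (pos xH + vel xH * dt E) (vel xH).
Proof.
move=> ct ct1 xH TxH; have [_ _ _ _ veh_ok] := E_ok.
by rewrite xass_horizon // output_phi_equilibrium.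
Qed.

(** The desired output also advances at constant speed, so once reached it is
    kept by the appended step.  The platoon has to be the same at both times
    because the desired output depends on the index. *)
Lemma yass_desired_next t i :
  let P := platoon P0 log t in
  (1 <= i <= size P)%N -> platoon P0 log t.+1 = P ->
  ypred E X P t i (horizon E) = y_des E i (horizon E) t ->
  yass E X P t.+1 i (horizon E) = y_des E i (horizon E) t.+1.
Proof.
move=> P iP PS yi; have [i0 _] := andP iP; have [_ _ _ s0S _] := E_ok.
have cP := member_mem (lv E) iP.
have [[_ _ T_h] _] := loop_optimal X_loop iP.
rewrite /yass -[i == 0%N]negbK -lt0n i0 /= output_xass_horizon ?PS //.
exact: y_des_next.
Qed.

Lemma in_neighbour_lt (c : config R) M i (j : 'I_M.+1) :
  unidirectional c M -> (1 <= i <= M)%N -> j \in Iset c M i -> (j < i)%N.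
Proof.
move=> uni iM; have [i0 _] := andP iM; rewrite !inE => /orP[/andP[j0 cij]|].
  by apply: uni cij => //; rewrite j0 -ltnS ltn_ord.
by rewrite /Pset; case: ifP => _; rewrite inE // => /eqP->.
Qed.

(** The parent of i in the spanning tree is an in-neighbour. *)
Lemma in_neighbours_gt0 (c : config R) M i :
  contains_spanning_tree ord0 (@com_graph R c M) ->
  (1 <= i <= M)%N -> (0 < #|Iset c M i|)%N.
Proof.
move=> [e' e'sub [_ parent _]] /andP[i0 iM].
have ilt : (i < M.+1)%N by [].
have [j eqj] := mem_card1 (parent (Ordinal ilt) (lt0n_neq0 i0)).
have e'j : e' j (Ordinal ilt) by have := eqj j; rewrite !inE eqxx.
by apply/card_gt0P; exists j; have /andP[] := e'sub _ _ e'j.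
Qed.

(** Every term of the mean in the terminal constraint is then the desired output
    of follower i.  Without in-neighbours the constraint would impose output 0
    instead. *)
Lemma ypred_desired_step t i :
  let P := platoon P0 log t in let c := cfg (stage log t) in
  (1 <= i <= size P)%N -> (0 < #|Iset c (size P) i|)%N ->
  (forall j : 'I_(size P).+1, j \in Iset c (size P) i ->
    yass E X P t j (horizon E) = y_des E j (horizon E) t) ->
  ypred E X P t i (horizon E) = y_des E i (horizon E) t.
Proof.
move=> P c iP I0 ya_des; have [[_ yE _] _] := loop_optimal X_loop iP.
rewrite /ypred yE (eq_bigr (fun=> y_des E i (horizon E) t)) => [|j /ya_des->].
  by rewrite sumr_const -scaler_nat scalerA mulVf ?scale1r // pnatr_eq0 -lt0n.
exact: y_des_offset.
Qed.

(** Strong induction on the index.  Announcements lag predictions by one step,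
    so each follower waits at most one step more than those in front of it; the
    leader's announcement has no lag, whence the shift i - 1 instead of i. *)
Lemma ypred_desired_constant_platoon P T :
  (forall t, (T <= t)%N -> platoon P0 log t = P) ->
  (forall t, (T <= t)%N -> unidirectional (cfg (stage log t)) (size P)) ->
  (forall t, (T <= t)%N ->
    contains_spanning_tree ord0 (@com_graph R (cfg (stage log t)) (size P))) ->
  forall i t, (1 <= i <= size P)%N -> (T + i.-1 <= t)%N ->
    ypred E X P t i (horizon E) = y_des E i (horizon E) t.
Proof.
move=> constP uni tree; elim/ltn_ind => i IHi t iP Tt.
have T_t : (T <= t)%N by apply: leq_trans Tt; apply: leq_addr.
have := @ypred_desired_step t i; rewrite constP //; apply => //.
  exact: in_neighbours_gt0 (tree t T_t) iP.
move=> j /(in_neighbour_lt (uni t T_t) iP) ji.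
case: (posnP j) => [->|j0]; first by rewrite /yass eqxx y_des_leader.
have jP : (1 <= j <= size P)%N by rewrite j0 -ltnS ltn_ord.
(* A follower hearing another follower has index at least 2, so that T < t and
   the announcement at t stems from a prediction made on the final platoon. *)
case: t Tt T_t => [|t] Tt T_t.
  move: Tt; rewrite leqn0 addn_eq0 -subn1 subn_eq0 leqNgt.
  by rewrite (leq_trans _ ji) ?andbF.
have Tjt : (T + j.-1 <= t)%N.
  rewrite -ltnS -addnS prednK //; apply: leq_trans Tt.
  by rewrite leq_add2l -ltnS prednK // (leq_trans _ ji).
have Tt' : (T <= t)%N by apply: leq_trans Tjt; apply: leq_addr.
have := @yass_desired_next t j; rewrite !constP //; apply => //.
exact: IHi.
Qed.

End Loop.

(** * The final platoon *)

(** Cut-outs are added on the left since subtraction is truncated. *)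
Lemma size_apply_maneuvers l (P : seq V) log : executable l P log ->
  (size (foldl (@apply_maneuver V) P log) + count (predC (@is_cut_in V)) log =
   size P + count (@is_cut_in V) log)%N.
Proof.
elim: log P => [|m log IHlog] P //= /andP[m_ok /IHlog].
case: m m_ok => [t n c|t c] /= m_ok.
  rewrite size_cat /= addnS -size_cat cat_take_drop => ->.
  by rewrite addSnnS.
have P0 : (0 < size P)%N by case: P m_ok.
by rewrite addnCA size_rem // => ->; rewrite addnA add1n prednK.
Qed.

Lemma platoon_final (P0 : seq V) log t :
  all (fun m => mtime m <= t)%N log ->
  platoon P0 log t = foldl (@apply_maneuver V) P0 log.
Proof. by rewrite all_count /platoon /stage => /eqP->; rewrite take_size. Qed.

End Platoon.

Theorem theorem2 (R : realType) (V : eqType) (E : setting R V)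
    (N Nci Nco : nat) (P0 : N.-tuple V) (log : seq (maneuver V))
    (tci : Nci.-tuple nat) (tco : Nco.-tuple nat)
    (cfg : nat -> config R) (X : run R V)
    (hE : setting_ok E)
    (hP0 : uniq (lv E :: P0))
    (hlog : valid_log (lv E) P0 log)
    (hci : perm_eq [seq mtime m | m <- log & is_cut_in m] tci)
    (hco : perm_eq [seq mtime m | m <- log & ~~ is_cut_in m] tco)
    (hweights : forall t,
       weights_ok (cfg (stage log t)) (size (platoon P0 log t)))
    (huni : forall t,
       unidirectional (cfg (stage log t)) (size (platoon P0 log t)))
    (htree : forall t,
       contains_spanning_tree ord0
         (@com_graph R (cfg (stage log t)) (size (platoon P0 log t))))
    (hX : closed_loop E P0 log cfg X) :
  let tconv :=
    (maxn (\max_(i < Nci) tnth tci i) (\max_(j < Nco) tnth tco j)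
     + N + Nci - Nco)%N in
  forall t : nat, (tconv <= t)%N ->
  forall i : nat, (1 <= i <= size (platoon P0 log t))%N ->
    ypred E X (platoon P0 log t) t i (horizon E) = y_des E i (horizon E) t.
Proof.
move=> tconv t tconv_t i iP.
set T := maxn _ _ in tconv tconv_t.
set P := foldl (@apply_maneuver V) P0 log.
have T_tci s : s \in tci -> (s <= T)%N.
  by case/tnthP=> k ->; rewrite leq_max (leq_bigmax k).
have T_tco s : s \in tco -> (s <= T)%N.
  by case/tnthP=> k ->; rewrite leq_max (leq_bigmax k) orbT.
have late : all (fun m => mtime m <= T)%N log.
  have : all (fun s => s <= T)%N [seq mtime m | m <- log & is_cut_in m].
    by rewrite (perm_all _ hci); apply/allP.
  have : all (fun s => s <= T)%N [seq mtime m | m <- log & ~~ is_cut_in m].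
    by rewrite (perm_all _ hco); apply/allP.
  rewrite !all_map !all_filter => late_co late_ci.
  have := conj late_ci late_co => /andP; rewrite -all_predI.
  by apply: sub_all => m /=; case: is_cut_in; rewrite ?andbT.
have constP s : (T <= s)%N -> platoon P0 log s = P.
  by move=> Ts; apply: platoon_final; apply: sub_all late => m /leq_trans; apply.
have sizeP : (size P + Nco = N + Nci)%N.
  have := size_apply_maneuvers hlog.2; rewrite size_tuple -!size_filter.
  have := perm_size hci; rewrite size_map size_tuple => ->.
  by have := perm_size hco; rewrite size_map size_tuple => ->.
have TP_t : (T + size P <= t)%N.
  by move: tconv_t; rewrite /tconv -addnA -sizeP addnA addnK.
have Tt : (T <= t)%N by apply: leq_trans TP_t; apply: leq_addr.
move: iP; rewrite constP // => iP; have [_ iszP] := andP iP.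
apply: (ypred_desired_constant_platoon hE hX constP) => // [s Ts|s Ts|].
- by rewrite -(constP s Ts).
- by rewrite -(constP s Ts).
by apply: leq_trans TP_t; rewrite leq_add2l (leq_trans (leq_pred i)).
Qed.
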